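(* Let $k, l \geq 1$ be natural numbers. Then there is a constant $A_{k,l}$ (depending only on $k,l$) such that for every $n$, in any red/blue-colouring of the edges of $K_n$, there are at least \[2^{-k(l-2) - \binom{k+1}{2}} \binom{n}{k} - A_{k,l}\, n^{k-1}\] red copies of $K_k$ or at least \[2^{-l(k-2) - \binom{l+1}{2}} \binom{n}{l} - A_{k,l}\, n^{l-1}\] blue copies of $K_l$.
   Context: A red copy of $K_k$ is a set of $k$ vertices all of whose pairs are coloured red; similarly for blue. A single vertex counts as both a red and a blue $K_1$. *)

(* Defs.v *)
From HB Require Import structures.
From mathcomp Require Import all_boot all_order all_algebra.
From mathcomp Require Import reals.

Set Implicit Arguments.
Unset Strict Implicit.
Unset Printing Implicit Defensive.

Definition edge (n : nat) : finType := {e : {set 'I_n} | #|e| == 2}.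

Definition red : bool := true.
Definition blue : bool := false.

(* The edges inside [S] are exactly the pairs of distinct elements of [S], so
   for [k = 1] the condition on edges is void and every vertex is a copy of
   K_1 in either colour. *)
Definition mono_copies (n : nat) (c : edge n -> bool) (col : bool) (k : nat) :
    {set {set 'I_n}} :=
  [set S : {set 'I_n} |
    (#|S| == k) && [forall e : edge n, (val e \subset S) ==> (c e == col)]].

(* Main.v *)
Require Import Defs.
From HB Require Import structures.
From mathcomp Require Import all_boot all_order all_algebra.
From mathcomp Require Import reals.
From mathcomp Require Import ring lra zify.

(** Erdős–Szekeres induction on [k + l].  Every vertex has red degree or blue
    degree at least [(n - 1) / 2], so one of the colours, say red, is a majority
    colour at half of the vertices.  Apply the case [(k - 1, l)] in the red
    neighbourhood of each of these vertices.  If one neighbourhood contains many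
    blue [K_l], then passing from about [n / 2] to [n] vertices costs exactly the
    factor [2 ^ l] by which the claimed blue densities differ.  Otherwise all of
    them contain many red [K_(k-1)], and summing over half of the vertices gives
    enough red [K_k], since [k <= k + l - 2]. *)

Set Implicit Arguments.
Unset Strict Implicit.
Unset Printing Implicit Defensive.

Import Order.TTheory GRing.Theory Num.Theory.

Local Open Scope ring_scope.

(** * Cliques, neighbourhoods and majority vertices *)

Section Cliques.
Variable T : finType.
Implicit Types (e f : rel T) (V S : {set T}) (v : T) (k : nat).

Definition cliques e k V : {set {set T}} :=
  [set S : {set T} | [&& S \subset V, #|S| == k &
    [forall x in S, forall y in S, (x != y) ==> e x y]]].

Definition neighbours e V v : {set T} := [set u in V | (u != v) && e v u].

Lemma cliquesP e k V S :
  reflect [/\ S \subset V, #|S| = k & {in S &, forall x y, x != y -> e x y}]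
    (S \in cliques e k V).
Proof.
rewrite inE; apply: (iffP and3P) => [[sSV /eqP cS /forall_inP h]|[sSV cS h]].
  by split=> // x y xS yS xy; have /forall_inP/(_ y yS)/implyP := h x xS; apply.
split=> //; first by apply/eqP.
apply/forall_inP => x xS; apply/forall_inP => y yS; apply/implyP; exact: h.
Qed.

Lemma cliquesS e k V S : S \subset V -> cliques e k S \subset cliques e k V.
Proof.
move=> sSV; apply/subsetP => U /cliquesP[sU cU h]; apply/cliquesP.
by split=> //; apply: subset_trans sU sSV.
Qed.

Lemma card_cliques1 e V : #|cliques e 1 V| = #|V|.
Proof.
rewrite -(card_imset _ (@set1_inj T)); apply: eq_card => S.
apply/cliquesP/imsetP => [[sSV /eqP/cards1P[x SE] _]|[x xV ->]].
  by exists x; rewrite // -sub1set -SE.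
by rewrite sub1set cards1; split=> // a b /set1P-> /set1P->; rewrite eqxx.
Qed.

Lemma neighbours_sub e V v : neighbours e V v \subset V.
Proof. by apply/subsetP => u; rewrite inE => /andP[]. Qed.

(** Adding [v] to a clique of its neighbourhood is injective, since [neighbours] excludes [v]. *)
Lemma cliques_neighbours_le e k V v : symmetric e -> v \in V ->
  (#|cliques e k (neighbours e V v)|
     <= #|[set S in cliques e k.+1 V | v \in S]|)%N.
Proof.
move=> es vV.
have vN S : S \in cliques e k (neighbours e V v) -> v \notin S.
  move=> /cliquesP[/subsetP sS _ _]; apply/negP => /sS.
  by rewrite inE eqxx andbF.
have inj : {in cliques e k (neighbours e V v) &, injective (setU [set v])}.
  by move=> S S' /vN vS /vN vS' eqSS'; rewrite -(setU1K vS) eqSS' setU1K.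
rewrite -(card_in_imset inj); apply/subset_leq_card/subsetP => _ /imsetP[S SC ->].
rewrite inE setU11 andbT; have vS := vN S SC.
move/cliquesP: SC => [/subsetP sS cS h]; apply/cliquesP; split.
- rewrite subUset sub1set vV; apply/subsetP => u /sS.
  by rewrite inE => /andP[].
- by rewrite cardsU1 vS cS.
- move=> x y /setU1P[->|xS] /setU1P[->|yS]; rewrite ?eqxx // => xy.
  + by have := sS y yS; rewrite inE => /and3P[].
  + by have := sS x xS; rewrite inE es => /and3P[].
  + exact: h.
Qed.

(** Double counting of the pairs formed by a clique of size [k.+1] and one of its vertices. *)
Lemma sum_cliques_neighbours_le e k V : symmetric e ->
  (\sum_(v in V) #|cliques e k (neighbours e V v)|
     <= k.+1 * #|cliques e k.+1 V|)%N.
Proof.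
move=> es.
apply: (@leq_trans (\sum_(v in V) \sum_(S in cliques e k.+1 V) (v \in S))).
  apply: leq_sum => v vV; apply: leq_trans (cliques_neighbours_le k es vV) _.
  rewrite -sum1_card -big_mkcondr /=.
  by apply/eq_leq/eq_bigl => S; rewrite inE.
rewrite exchange_big /= mulnC -sum_nat_const.
apply: leq_sum => S /cliquesP[sSV cS _].
rewrite -big_mkcondr /= sum1_card -cS; apply: subset_leq_card.
by apply/subsetP => x /andP[].
Qed.

Lemma card_neighbours_cover e f V v : v \in V ->
    (forall x y, x != y -> e x y || f x y) ->
  (#|V| <= (#|neighbours e V v| + #|neighbours f V v|).+1)%N.
Proof.
move=> vV cov; rewrite (cardsD1 v V) vV add1n ltnS.
apply: leq_trans (leq_card_setU _ _); apply: subset_leq_card.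
apply/subsetP => u; rewrite !inE => /andP[uv ->]; rewrite uv /=.
by apply: cov; rewrite eq_sym.
Qed.

(** Degree at least [(#|V| - 1) / 2], written without subtraction; a vertex may qualify for both
    relations. *)
Definition majority e V : {set T} :=
  [set v in V | (#|V| <= (#|neighbours e V v|.*2).+1)%N].

Lemma majority_cover e f V : (forall x y, x != y -> e x y || f x y) ->
  (#|V| <= #|majority e V|.*2)%N \/ (#|V| <= #|majority f V|.*2)%N.
Proof.
move=> cov.
suff: (#|V| <= #|majority e V| + #|majority f V|)%N by lia.
apply: leq_trans (leq_card_setU _ _); apply/subset_leq_card/subsetP => v vV.
rewrite !inE vV /=; have := card_neighbours_cover vV cov; lia.
Qed.

End Cliques.

(** * Estimates for powers and for the leading coefficients *)

Section Densities.
Variable R : realFieldType.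
Implicit Types (x d A C : R) (k l m : nat).

(** Shows that having degree [(x - 1) / 2] instead of [x / 2] costs only a lower-order term. *)
Lemma expr_le_sub1 x m : 1 <= x ->
  x ^+ m.+1 <= (x - 1) ^+ m.+1 + m.+1%:R * x ^+ m.
Proof.
move=> x1; elim: m => [|m IHm]; first by rewrite !expr1 expr0; lra.
have le1 : (x - 1) ^+ m.+1 <= x ^+ m.+1 by apply: lerXn2r; rewrite ?nnegrE; lra.
have : x * x ^+ m.+1 <= x * ((x - 1) ^+ m.+1 + m.+1%:R * x ^+ m).
  by rewrite ler_pM2l //; lra.
rewrite (exprS x m.+1) (exprS (x - 1) m.+1) -(natr1 m.+1) => le2.
apply: le_trans le2 _.
(* The last summand is at most [x ^+ m.+1] by [le1], which raises the coefficient by 1. *)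
have -> : x * ((x - 1) ^+ m.+1 + m.+1%:R * x ^+ m)
  = (x - 1) * (x - 1) ^+ m.+1 + m.+1%:R * x ^+ m.+1 + (x - 1) ^+ m.+1.
  by rewrite (exprS x m); ring.
by rewrite [(_ + 1) * _]mulrDl mul1r addrA lerD2l.
Qed.

(** Carries a bound from a neighbourhood of size [d] to a set of size [x]: [(x - 1) / 2 <= d] serves
    the leading term, [d <= x] the subtracted one. *)
Lemma half_degree_bound x d A C m :
    1 <= x -> x <= 2 * d + 1 -> d <= x -> 0 <= A -> 0 <= C ->
  C / 2 ^+ m.+1 * x ^+ m.+1 - (C * m.+1%:R + A) * x ^+ m
    <= C * d ^+ m.+1 - A * d ^+ m.
Proof.
move=> x1 xd dx A0 C0.
have d0 : 0 <= d by lra.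
have leA : A * d ^+ m <= A * x ^+ m.
  by apply: ler_wpM2l => //; apply: lerXn2r; rewrite ?nnegrE; lra.
have leC : C / 2 ^+ m.+1 * x ^+ m.+1 - C * m.+1%:R * x ^+ m <= C * d ^+ m.+1.
  have p1 : 1 <= (2 : R) ^+ m.+1 by apply: exprn_ege1; lra.
  have p0 : (2 : R) ^+ m.+1 != 0 by rewrite expf_neq0 // pnatr_eq0.
  have le2 : (x - 1) ^+ m.+1 <= 2 ^+ m.+1 * d ^+ m.+1.
    by rewrite -exprMn; apply: lerXn2r; rewrite ?nnegrE; lra.
  have le3 := expr_le_sub1 m x1.
  have y0 : 0 <= m.+1%:R * x ^+ m by rewrite mulr_ge0 // exprn_ge0 //; lra.
  (* The factor inserted here cancels against [C / 2 ^+ m.+1]. *)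
  have le4 : m.+1%:R * x ^+ m <= 2 ^+ m.+1 * (m.+1%:R * x ^+ m).
    by apply: ler_peMl.
  have : C / 2 ^+ m.+1 * x ^+ m.+1
      <= C / 2 ^+ m.+1 * (2 ^+ m.+1 * (d ^+ m.+1 + m.+1%:R * x ^+ m)).
    apply: ler_wpM2l; first by rewrite divr_ge0 // exprn_ge0.
    by lra.
  rewrite mulrA divfK //; lra.
lra.
Qed.

(* In terms of the exponent of the theorem,
   [k * (l - 1) + 'C(k, 2) = k * (l - 2) + 'C(k + 1, 2)]; for [1 <= l] no
   truncation occurs on the left. *)
Definition density k l : R := (2 ^+ (k * l.-1 + 'C(k, 2)))^-1 / k`!%:R.

Lemma density_ge0 k l : 0 <= density k l.
Proof. by rewrite divr_ge0 // invr_ge0 exprn_ge0. Qed.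

Lemma density_pass k l : density l k.+1 / 2 ^+ l = density l k.+2.
Proof.
rewrite /density /= mulrAC -invfM -exprD.
by congr ((2 ^+ _)^-1 / _); rewrite mulnS; lia.
Qed.

(** In [2 ^+ k.+2], [k.+1] halvings come from the neighbourhood size and one from summing over half
    of the vertices; [k.+2] is the double-counting multiplicity. The exponents of 2 on the two sides
    differ by exactly [l]. *)
Lemma density_step k l :
  density k.+2 l.+2 <= density k.+1 l.+2 / 2 ^+ k.+2 / k.+2%:R.
Proof.
rewrite /density /= factS natrM.
have -> (a b c p : R) : a / b / c / p = a / c / (p * b).
  by rewrite invfM; ring.
apply: ler_wpM2r; first by rewrite invr_ge0 -natrM.
rewrite -invfM -exprD lef_pV2 ?posrE ?exprn_gt0 //.
apply: ler_weXn2l; first by lra.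
rewrite [in X in (_ <= X)%N]binS bin1; lia.
Qed.

End Densities.

(** * The induction on the two clique sizes *)

Section Induction.
Variable R : realFieldType.

(** Powers replace binomials because they scale exactly under halving; the subset [V] lets the
    induction descend into neighbourhoods. *)
Definition many_cliques (A : R) (k l : nat) (T : finType) (e : rel T)
    (V : {set T}) : Prop :=
  density R k l * #|V|%:R ^+ k - A * #|V|%:R ^+ k.-1 <= #|cliques e k V|%:R.

(* Overlapping [e] and [f] are allowed: this makes the two colours
   interchangeable and only requires that together they cover all pairs. *)
Definition ramsey_multiplicity (k l : nat) : Prop :=
  exists2 A : R, 0 <= A & forall (T : finType) (e f : rel T) (V : {set T}),
    symmetric e -> symmetric f -> (forall x y, x != y -> e x y || f x y) ->
    many_cliques A k l e V \/ many_cliques A l k f V.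

Lemma ramsey_multiplicity_sym k l :
  ramsey_multiplicity k l -> ramsey_multiplicity l k.
Proof.
case=> A A0 h; exists A => // T e f V es fs cov.
by case: (h T f e V fs es) => [x y xy||]; [rewrite orbC cov | right | left].
Qed.

Lemma many_cliquesW (A B : R) k l (T : finType) (e : rel T) (V : {set T}) :
  A <= B -> many_cliques A k l e V -> many_cliques B k l e V.
Proof.
move=> AB; apply: le_trans; rewrite lerD2l lerN2.
by apply: ler_wpM2r => //; rewrite exprn_ge0.
Qed.

Lemma ramsey_multiplicity_1 l : ramsey_multiplicity 1 l.
Proof.
exists 0 => // T e f V _ _ _; left.
rewrite /many_cliques card_cliques1 expr1 mul0r subr0 ler_piMl //.
rewrite /density divr1 invf_le1 ?exprn_gt0 // exprn_ege1 //; lra.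
Qed.

Lemma ramsey_multiplicity_majority k l : ramsey_multiplicity k.+1 l.+2 ->
  exists2 A : R, 0 <= A & forall (T : finType) (e f : rel T) (V : {set T}),
    symmetric e -> symmetric f -> (forall x y, x != y -> e x y || f x y) ->
    (#|V| <= #|majority e V|.*2)%N ->
    many_cliques A k.+2 l.+2 e V \/ many_cliques A l.+2 k.+2 f V.
Proof.
case=> A A0 h.
pose C1 := density R k.+1 l.+2; pose C2 := density R l.+2 k.+1.
have C1_ge0 : 0 <= C1 := density_ge0 _ _ _.
have C2_ge0 : 0 <= C2 := density_ge0 _ _ _.
(* The lower-order coefficients that [half_degree_bound] produces for [e] and for [f]. *)
pose A1 := C1 * k.+1%:R + A; pose A2 := C2 * l.+2%:R + A.
have A1_ge0 : 0 <= A1 by rewrite addr_ge0 // mulr_ge0.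
have A2_ge0 : 0 <= A2 by rewrite addr_ge0 // mulr_ge0.
exists (A1 + A2); first exact: addr_ge0.
move=> T e f V es fs cov maj.
have deg v : v \in majority e V ->
    [/\ 1 <= #|V|%:R :> R, #|V|%:R <= 2 * #|neighbours e V v|%:R + 1 :> R
      & #|neighbours e V v|%:R <= #|V|%:R :> R].
  rewrite inE => /andP[vV degv]; split.
  - by rewrite ler1n card_gt0; apply/set0Pn; exists v.
  - by rewrite -natrM natr1 ler_nat mul2n.
  - by rewrite ler_nat subset_leq_card // neighbours_sub.
have [/existsP[v /andP[vM blue_v]]|/existsPn red_v] :=
    boolP [exists v, (v \in majority e V) &&
      (C2 * #|neighbours e V v|%:R ^+ l.+2 - A * #|neighbours e V v|%:R ^+ l.+1
        <= #|cliques f l.+2 (neighbours e V v)|%:R)].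
  right; apply: (@many_cliquesW A2); first by rewrite lerDr.
  have [x1 xd dx] := deg v vM.
  rewrite /many_cliques -density_pass.
  apply: le_trans (half_degree_bound l.+1 x1 xd dx A0 C2_ge0) _.
  apply: le_trans blue_v _; rewrite ler_nat.
  exact/subset_leq_card/cliquesS/neighbours_sub.
left; apply: (@many_cliquesW A1); first by rewrite lerDl.
set x : R := #|V|%:R; set N := cliques e k.+2 V.
pose B : R := C1 / 2 ^+ k.+1 * x ^+ k.+1 - A1 * x ^+ k.
have leB v : v \in majority e V ->
    B <= #|cliques e k.+1 (neighbours e V v)|%:R.
  move=> vM; have [x1 xd dx] := deg v vM.
  apply: le_trans (half_degree_bound k x1 xd dx A0 C1_ge0) _.
  have := red_v v; rewrite vM /= => /negP nblue.
  by case: (h T e f (neighbours e V v) es fs cov).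
have sumB : #|majority e V|%:R * B <= k.+2%:R * #|N|%:R.
  apply: (@le_trans _ _
    (\sum_(v in V) #|cliques e k.+1 (neighbours e V v)|)%:R); last first.
    by rewrite -natrM ler_nat; apply: sum_cliques_neighbours_le.
  rewrite mulr_natl -sumr_const.
  apply: le_trans (ler_sum _ leB) _; rewrite natr_sum.
  rewrite [leRHS](big_setID (majority e V)) /=.
  rewrite (setIidPr _); last by apply/subsetP => v; rewrite inE => /andP[].
  by rewrite lerDl sumr_ge0.
have x0 : 0 <= x by [].
have halfB : x / 2 * B <= k.+2%:R * #|N|%:R.
  (* If [B] is negative, [sumB] cannot be weakened to half of the vertices, but then the left side
     is at most 0. *)
  have [B0|/ltW B0] := lerP 0 B.
    apply: le_trans sumB; apply: ler_wpM2r => //.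
    rewrite ler_pdivrMr // -natrM ler_nat; lia.
  by apply: (@le_trans _ _ 0); rewrite ?mulr_ge0 // mulr_ge0_le0 // divr_ge0.
have k0 : 0 < k.+2%:R :> R by [].
have : x / 2 * B / k.+2%:R <= #|N|%:R by rewrite ler_pdivrMr // [leRHS]mulrC.
rewrite /many_cliques; apply: le_trans.
have -> : x / 2 * B / k.+2%:R
  = C1 / 2 ^+ k.+2 / k.+2%:R * x ^+ k.+2 - A1 * x ^+ k.+1 / (2 * k.+2%:R).
  rewrite /B !exprS; field.
  by rewrite -natrD expf_neq0 pnatr_eq0.
(* [density_step] compares the leading terms; dividing the error by [2 * k.+2%:R >= 1] only shrinks
   it. *)
apply: lerB.
  by apply: ler_wpM2r (density_step _ _ _); rewrite exprn_ge0.
rewrite ler_pdivrMr ?mulr_gt0 // ler_peMr ?mulr_ge0 ?exprn_ge0 //.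
by rewrite -natrM ler1n.
Qed.

Lemma ramsey_multiplicityP k l : ramsey_multiplicity k.+1 l.+1.
Proof.
have [m] := ubnP (k + l); elim: m k l => // m IHm [|k] [|l] le_m.
- exact: ramsey_multiplicity_1.
- exact: ramsey_multiplicity_1.
- exact/ramsey_multiplicity_sym/ramsey_multiplicity_1.
have /ramsey_multiplicity_majority[A A0 hA] : ramsey_multiplicity k.+1 l.+2.
  by apply: IHm; lia.
(* The same step with the two relations exchanged, for the case where [f] is the majority. *)
have /ramsey_multiplicity_majority[B B0 hB] : ramsey_multiplicity l.+1 k.+2.
  by apply: IHm; lia.
have leA : A <= A + B by rewrite lerDl.
have leB : B <= A + B by rewrite lerDr.
exists (A + B) => [|T e f V es fs cov]; first exact: addr_ge0.
have [maj|maj] := majority_cover V cov.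
  by case: (hA T e f V es fs cov maj) => /(many_cliquesW leA); [left|right].
have cov' x y : x != y -> f x y || e x y by rewrite orbC; apply: cov.
by case: (hB T f e V fs es cov' maj) => /(many_cliquesW leB); [right|left].
Qed.

End Induction.

(** * From edge colourings to pairs of relations *)

Definition coloured_by n (c : edge n -> bool) (col : bool) : rel 'I_n :=
  fun x y => [forall e : edge n, (val e == [set x; y]) ==> (c e == col)].

Lemma coloured_by_sym n (c : edge n -> bool) col : symmetric (coloured_by c col).
Proof. by move=> x y; rewrite /coloured_by setUC. Qed.

Lemma coloured_by_cover n (c : edge n -> bool) (x y : 'I_n) : x != y ->
  coloured_by c red x y || coloured_by c blue x y.
Proof.
move=> xy; have cxy : #|[set x; y]| == 2 by rewrite cards2 xy.
pose exy : edge n := exist (fun e : {set 'I_n} => #|e| == 2) _ cxy.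
have forced col : c exy = col -> coloured_by c col x y.
  move=> <-; apply/forallP => e; apply/implyP => /eqP eE.
  by apply/eqP; congr c; apply: val_inj.
by case cE: (c exy); rewrite (forced _ cE) ?orbT.
Qed.

(** [coloured_by] holds vacuously on the diagonal, but [cliques] tests only distinct vertices, and
    these form an edge. *)
Lemma cliques_coloured_by n (c : edge n -> bool) col k :
  cliques (coloured_by c col) k [set: 'I_n] = mono_copies c col k.
Proof.
apply/setP => S; rewrite [in RHS]inE.
apply/cliquesP/andP => [[_ /eqP -> h]|[/eqP cS /forallP h]]; split=> //.
  apply/forallP => e; apply/implyP => eS.
  have /cards2P[x [y [xy eE]]] := valP e.
  move: eS; rewrite eE subUset !sub1set => /andP[xS yS].
  by have /forallP/(_ e) := h x y xS yS xy; rewrite eE eqxx.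
move=> x y xS yS xy; apply/forallP => e; apply/implyP => /eqP eE.
by have := h e; rewrite eE subUset !sub1set xS yS.
Qed.

(** For [l = 1] the term [- k * (l - 2)] equals [k]; it is absorbed by
    ['C(k.+1, 2) = 'C(k, 2) + k]. *)
Lemma exprz_density (R : numFieldType) (k l : nat) : (1 <= l)%N ->
  (2 : R) ^ (- (k%:Z * (l%:Z - 2)) - ('C(k.+1, 2))%:Z)
    = (2 ^+ (k * l.-1 + 'C(k, 2)))^-1.
Proof.
case: l => // l _; rewrite exprnN; congr (_ ^ _); rewrite binS bin1 /=; lia.
Qed.

(** The falling factorial is at most [n ^ k], so bounds in terms of powers imply those with
    binomials. *)
Lemma bin_le_expr (R : numFieldType) (n k : nat) :
  'C(n, k)%:R <= n%:R ^+ k / k`!%:R :> R.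
Proof.
rewrite ler_pdivlMr ?ltr0n ?fact_gt0 // -natrM -natrX ler_nat bin_ffact.
elim: k n => [|k IHk] [|n] //; rewrite ffactnS expnS leq_mul2l /=.
by apply: leq_trans (IHk n) _; case: k {IHk} => // k; rewrite leq_exp2r.
Qed.

Theorem theorem2 (R : realType) (k l : nat) (hk : (1 <= k)%N) (hl : (1 <= l)%N) :
  exists A : R, forall (n : nat) (c : edge n -> bool),
    (2 : R) ^ (- (k%:Z * (l%:Z - 2)) - ('C(k.+1, 2))%:Z) * ('C(n, k))%:R
      - A * n%:R ^+ (k - 1) <= #|mono_copies c red k|%:R
    \/
    (2 : R) ^ (- (l%:Z * (k%:Z - 2)) - ('C(l.+1, 2))%:Z) * ('C(n, l))%:R
      - A * n%:R ^+ (l - 1) <= #|mono_copies c blue l|%:R.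
Proof.
have [A _ hA] := ramsey_multiplicityP R k.-1 l.-1.
rewrite !prednK // in hA.
have fin (i j n : nat) (c : edge n -> bool) col : (1 <= j)%N ->
    many_cliques A i j (coloured_by c col) [set: 'I_n] ->
  (2 : R) ^ (- (i%:Z * (j%:Z - 2)) - ('C(i.+1, 2))%:Z) * ('C(n, i))%:R
      - A * n%:R ^+ (i - 1) <= #|mono_copies c col i|%:R.
  move=> j0; rewrite /many_cliques cardsT card_ord cliques_coloured_by subn1.
  apply: le_trans; rewrite lerD2r exprz_density // /density -mulrA.
  apply: ler_wpM2l; first by rewrite invr_ge0 exprn_ge0.
  by rewrite [leRHS]mulrC bin_le_expr.
exists A => n c.
have [|||/fin|/fin] := hA _ (coloured_by c red) (coloured_by c blue) [set: 'I_n].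
- exact: coloured_by_sym.
- exact: coloured_by_sym.
- exact: coloured_by_cover.
- by left; auto.
- by right; auto.
Qed.
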